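(* Let $\mathcal V$ be a variety of $R$-modules expanded by multilinear operations named by $F$, and let $Q,I\in\mathcal V$. A cohomology class $[T]\in H^2_{\mathcal V}(Q,I)$ (with $T$ a $\mathcal V$-compatible 2-cocycle) represents an extension $\pi:M\to Q$ in which $I=\ker\pi\triangleleft M$ determines an abelian congruence if and only if $I$ is an abelian algebra and $T$ is linear.
   Context: $R$ is a fixed ring, $F$ a set of operation symbols of finite positive arities $\mathrm{ar} f$, and ${}_R\mathcal M_F$ is the variety of all $R$-modules expanded by an $R$-multilinear operation for each $f\in F$, in the signature $\{+,-,0\}\cup R\cup F$. A variety of $R$-modules expanded by multilinear operations is a subvariety of ${}_R\mathcal M_F$; $\mathrm{Id}\,\mathcal V$ is its set of identities. An ideal $K\triangleleft M$ is a submodule with $f(\vec x)\in K$ whenever some $x_i\in K$; it determines the congruence $\alpha_K=\{(a,b):a-b\in K\}$. $[n]=\{1,\dots,n\}$, $[n]^\ast$ is the set of nonempty proper subsets of $[n]$; $\vec q_s[\vec p]$ is $\vec q$ with the coordinates in $s$ replaced by those of $\vec p$. Commutator. For congruences $\alpha,\beta,\delta$ of an algebra, $C(\alpha,\beta;\delta)$ holds if for all terms $t(\vec x,\vec y)$ and tuples $\vec a\mathrel{\alpha}\vec b$, $\vec c\mathrel{\beta}\vec d$ (coordinatewise), $t(\vec a,\vec c)\mathrel{\delta}t(\vec a,\vec d)$ implies $t(\vec b,\vec c)\mathrel{\delta}t(\vec b,\vec d)$; $[\alpha,\beta]=\bigcap\{\delta:C(\alpha,\beta;\delta)\}$. A congruence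 $\alpha$ is abelian if $[\alpha,\alpha]=0$; an algebra is abelian if $[1,1]=0$, where $1$ is its total congruence. A 2-cocycle $T$ for $(Q,I)$ consists of factor sets $T_+:Q^2\to I$, $T_r:Q\to I$ $(r\in R)$, $T_f:Q^{\mathrm{ar} f}\to I$ $(f\in F)$ with $T_+(x,0)=T_+(0,x)=0$, $T_r(0)=0$, $T_f(\vec x)=0$ if some $x_i=0$, and action terms $a(f,s):Q^n\times I^n\to I$ ($f\in F$, $n=\mathrm{ar} f$, $s\in[n]^\ast$), where $a(f,s)(\vec q,\vec a)$ depends only on $q_j$ ($j\notin s$) and $a_j$ ($j\in s$), is $R$-multilinear in the $a_j$, $j\in s$, and vanishes if $q_j=0$ for some $j\notin s$. $T$ is linear if its action terms are unary in $I$, i.e. $a(f,s)\equiv0$ whenever $|s|>1$. The algebra $I\rtimes_TQ$ has universe $I\times Q$ and $\langle a,x\rangle+\langle b,y\rangle=\langle a+b+T_+(x,y),x+y\rangle$, $-\langle a,x\rangle=\langle -a-T_+(x,-x),-x\rangle$, $r\cdot\langle a,x\rangle=\langle r\cdot a+T_r(x),r\cdot x\rangle$, $F_f(\langle a_1,x_1\rangle,\dots,\langle a_n,x_n\rangle)=\langle f^I(\vec a)+\sum_{s\in[n]^\ast}a(f,s)(\vec x,\vec a)+T_f(\vec x),f^Q(\vec x)\rangle$. For a term $t$, write its interpretation in $I\rtimes_TQ$ as $\langle t^I(\vec a)+D^T_t(\vec a,\vec q),t^Q(\vec q)\rangle$; $T$ is $\mathcal V$-compatible if $D^T_t=D^T_s$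 for all $t=s\in\mathrm{Id}\,\mathcal V$. 2-cocycles $T$ (action terms $a(f,s)$) and $T'$ (action terms $a'(f,s)$) are equivalent, $T\sim T'$, if there is $h:Q\to I$ with $h(0)=0$ such that, with $n=\mathrm{ar} f$: $(T-T')_+(x,y)=h(x)+h(y)-h(x+y)$; $(T-T')_r(x)=r\cdot h(x)-h(r\cdot x)$; $(T-T')_f(\vec x)=\sum_{s\in[n]^\ast}(-1)^{1+|s|}a(f,s)(\vec x,h(\vec x))+(-1)^{1+n}f^I(h(\vec x))-h(f^Q(\vec x))$; $(a(f,s)-a'(f,s))(\vec x,\vec a)=\sum_{s\subsetneq r\in[n]^\ast}(-1)^{1+|r|-|s|}a(f,r)(\vec x,h(\vec x)_s[\vec a])+(-1)^{1+n-|s|}f^I(h(\vec x)_s[\vec a])$. $H^2_{\mathcal V}(Q,I)$ is the set of equivalence classes of $\mathcal V$-compatible 2-cocycles. The class $[T]$ represents the extensions equivalent to the second projection $I\rtimes_TQ\to Q$, with $I$ identified with $I\times\{0\}$ (equivalent: isomorphic by an isomorphism which is the identity on $I$ and commutes with the maps onto $Q$). *)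

(* Defs.v *)
From HB Require Import structures.
From mathcomp Require Import all_boot all_order all_algebra.

Set Implicit Arguments.
Unset Strict Implicit.
Unset Printing Implicit Defensive.

Import GRing.Theory.
Local Open Scope ring_scope.

(* [subst_on s p q] is $\vec q_s[\vec p]$. *)
Definition subst_on (n : nat) (A : Type) (s : {set 'I_n})
    (p q : {ffun 'I_n -> A}) : {ffun 'I_n -> A} :=
  [ffun i => if i \in s then p i else q i].

Definition update (n : nat) (A : Type) (x : {ffun 'I_n -> A}) (i : 'I_n)
    (u : A) : {ffun 'I_n -> A} :=
  [ffun j => if j == i then u else x j].

Definition multilinear_on (R : pzRingType) (n : nat) (A B : lmodType R)
    (s : {set 'I_n}) (g : {ffun 'I_n -> A} -> B) : Prop :=
  forall i, i \in s -> forall x, linear (fun u => g (update x i u)).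

Record opsig := Opsig {
  opsym :> Type;
  arity : opsym -> nat;
  arity_gt0 : forall f, (0 < arity f)%N
}.

(* Algebras in the signature {+, -, 0} U R U F, with no axioms imposed: the   *)
(* algebra built from a 2-cocycle is in general only of this kind.            *)
Record algebra (R : pzRingType) (F : opsig) := Algebra {
  carrier :> Type;
  alg_zero : carrier;
  alg_add : carrier -> carrier -> carrier;
  alg_opp : carrier -> carrier;
  alg_scale : R -> carrier -> carrier;
  alg_op : forall f : F, {ffun 'I_(arity f) -> carrier} -> carrier
}.

Inductive term (R : pzRingType) (F : opsig) (X : Type) : Type :=
| TVar of X
| TZero
| TAdd of term R F X & term R F X
| TOpp of term R F X
| TScale of R & term R F X
| TOp (f : F) of ('I_(arity f) -> term R F X).

Fixpoint teval (R : pzRingType) (F : opsig) (X : Type) (A : algebra R F)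
    (v : X -> A) (t : term R F X) {struct t} : A :=
  match t with
  | TVar x => v x
  | TZero => alg_zero A
  | TAdd t1 t2 => alg_add (teval v t1) (teval v t2)
  | TOpp t1 => alg_opp (teval v t1)
  | TScale r t1 => alg_scale r (teval v t1)
  | TOp f ts => alg_op [ffun i => teval v (ts i)]
  end.

Definition satisfies (R : pzRingType) (F : opsig) (A : algebra R F)
    (t s : term R F nat) : Prop :=
  forall v : nat -> A, teval v t = teval v s.

Record is_hom (R : pzRingType) (F : opsig) (A B : algebra R F)
    (phi : A -> B) : Prop := IsHom {
  hom_zero : phi (alg_zero A) = alg_zero B;
  hom_add : forall x y, phi (alg_add x y) = alg_add (phi x) (phi y);
  hom_opp : forall x, phi (alg_opp x) = alg_opp (phi x);
  hom_scale : forall r x, phi (alg_scale r x) = alg_scale r (phi x);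
  hom_op : forall (f : F) (x : {ffun 'I_(arity f) -> A}),
    phi (alg_op x) = alg_op [ffun i => phi (x i)]
}.

Record is_congruence (R : pzRingType) (F : opsig) (A : algebra R F)
    (d : A -> A -> Prop) : Prop := IsCongruence {
  cong_refl : forall x, d x x;
  cong_sym : forall x y, d x y -> d y x;
  cong_trans : forall x y z, d x y -> d y z -> d x z;
  cong_add : forall x x' y y', d x x' -> d y y' ->
    d (alg_add x y) (alg_add x' y');
  cong_opp : forall x x', d x x' -> d (alg_opp x) (alg_opp x');
  cong_scale : forall r x x', d x x' -> d (alg_scale r x) (alg_scale r x');
  cong_op : forall (f : F) (x x' : {ffun 'I_(arity f) -> A}),
    (forall i, d (x i) (x' i)) -> d (alg_op x) (alg_op x')
}.

Definition val2 (X Y A : Type) (a : X -> A) (c : Y -> A) (z : X + Y) : A :=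
  match z with inl x => a x | inr y => c y end.

Definition centralizes (R : pzRingType) (F : opsig) (A : algebra R F)
    (al be de : A -> A -> Prop) : Prop :=
  forall (m k : nat) (t : term R F ('I_m + 'I_k)) (a b : 'I_m -> A)
    (c d : 'I_k -> A),
  (forall i, al (a i) (b i)) -> (forall j, be (c j) (d j)) ->
  de (teval (val2 a c) t) (teval (val2 a d) t) ->
  de (teval (val2 b c) t) (teval (val2 b d) t).

Definition commutator (R : pzRingType) (F : opsig) (A : algebra R F)
    (al be : A -> A -> Prop) (x y : A) : Prop :=
  forall de, is_congruence de -> centralizes al be de -> de x y.

Definition abelian_congruence (R : pzRingType) (F : opsig) (A : algebra R F)
    (al : A -> A -> Prop) : Prop :=
  forall x y, commutator al al x y <-> x = y.

Definition abelian_algebra (R : pzRingType) (F : opsig) (A : algebra R F) :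
    Prop :=
  abelian_congruence (A := A) (fun _ _ => True).

(* The members of ${}_R\mathcal M_F$. *)
Record mlalg (R : pzRingType) (F : opsig) := MLAlg {
  ml_module :> lmodType R;
  ml_op : forall f : F, {ffun 'I_(arity f) -> ml_module} -> ml_module;
  ml_op_multilinear : forall f : F, multilinear_on [set: 'I_(arity f)] (@ml_op f)
}.

Definition to_algebra (R : pzRingType) (F : opsig) (A : mlalg R F) : algebra R F :=
  {| carrier := A;
     alg_zero := 0;
     alg_add := fun x y => x + y;
     alg_opp := fun x => - x;
     alg_scale := fun r x => r *: x;
     alg_op := @ml_op R F A |}.

Record variety (R : pzRingType) (F : opsig) := Variety {
  in_variety :> mlalg R F -> Prop;
  variety_equational : exists E : term R F nat -> term R F nat -> Prop,
    forall A, in_variety A <-> (forall t s, E t s -> satisfies (to_algebra A) t s)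
}.

Definition identities (R : pzRingType) (F : opsig) (V : variety R F)
    (t s : term R F nat) : Prop :=
  forall A, V A -> satisfies (to_algebra A) t s.

Record ideal (R : pzRingType) (F : opsig) (M : mlalg R F) := Ideal {
  in_ideal :> M -> Prop;
  ideal0 : in_ideal 0;
  idealD : forall x y, in_ideal x -> in_ideal y -> in_ideal (x + y);
  idealZ : forall (r : R) x, in_ideal x -> in_ideal (r *: x);
  ideal_op : forall (f : F) (x : {ffun 'I_(arity f) -> M}) (i : 'I_(arity f)),
    in_ideal (x i) -> in_ideal (ml_op x)
}.

Definition ideal_congruence (R : pzRingType) (F : opsig) (M : mlalg R F)
    (K : ideal M) (a b : to_algebra M) : Prop :=
  K ((a : M) - (b : M)).

(* [star n] is $[n]^\ast$. *)
Definition star (n : nat) : {set {set 'I_n}} :=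
  [set s : {set 'I_n} | (s != set0) && (s != [set: 'I_n])].

(* [act f s] is the action term $a(f,s)$; it is meaningful only for           *)
(* [s \in star (arity f)], and its values at other [s] are never used.        *)
Record cocycle (R : pzRingType) (F : opsig) (Q I : mlalg R F) := Cocycle {
  T_add : Q -> Q -> I;
  T_scale : R -> Q -> I;
  T_op : forall f : F, {ffun 'I_(arity f) -> Q} -> I;
  act : forall f : F, {set 'I_(arity f)} ->
    {ffun 'I_(arity f) -> Q} -> {ffun 'I_(arity f) -> I} -> I;
  T_add_x0 : forall x, T_add x 0 = 0;
  T_add_0x : forall x, T_add 0 x = 0;
  T_scale_0 : forall r, T_scale r 0 = 0;
  T_op_0 : forall (f : F) (x : {ffun 'I_(arity f) -> Q}) (i : 'I_(arity f)),
    x i = 0 -> T_op x = 0;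
  act_dep : forall (f : F) (s : {set 'I_(arity f)}), s \in star (arity f) ->
    forall (q q' : {ffun 'I_(arity f) -> Q}) (a a' : {ffun 'I_(arity f) -> I}),
    (forall j, j \notin s -> q j = q' j) -> (forall j, j \in s -> a j = a' j) ->
    act s q a = act s q' a';
  act_multilinear : forall (f : F) (s : {set 'I_(arity f)}),
    s \in star (arity f) -> forall q, multilinear_on s (act s q);
  act_0 : forall (f : F) (s : {set 'I_(arity f)}), s \in star (arity f) ->
    forall (q : {ffun 'I_(arity f) -> Q}) a j, j \notin s -> q j = 0 -> act s q a = 0
}.

Definition linear_cocycle (R : pzRingType) (F : opsig) (Q I : mlalg R F)
    (T : cocycle Q I) : Prop :=
  forall (f : F) (s : {set 'I_(arity f)}), s \in star (arity f) ->
  (1 < #|s|)%N -> forall q a, act T s q a = 0.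

(* $I \rtimes_T Q$. *)
Definition semidirect (R : pzRingType) (F : opsig) (Q I : mlalg R F)
    (T : cocycle Q I) : algebra R F :=
  {| carrier := (I * Q)%type;
     alg_zero := (0, 0);
     alg_add := fun u v => (u.1 + v.1 + T_add T u.2 v.2, u.2 + v.2);
     alg_opp := fun u => (- u.1 - T_add T u.2 (- u.2), - u.2);
     alg_scale := fun r u => (r *: u.1 + T_scale T r u.2, r *: u.2);
     alg_op := fun f p =>
       let a := [ffun i => (p i).1] in
       let x := [ffun i => (p i).2] in
       (ml_op a + \sum_(s in star (arity f)) act T s x a + T_op T x, ml_op x) |}.

(* $D^T_t(\vec a,\vec q)$. *)
Definition cocycle_defect (R : pzRingType) (F : opsig) (Q I : mlalg R F)
    (T : cocycle Q I) (t : term R F nat) (a : nat -> I) (q : nat -> Q) : I :=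
  (teval (A := semidirect T) (fun x => (a x, q x)) t).1
    - teval (A := to_algebra I) a t.

Definition compatible (R : pzRingType) (F : opsig) (Q I : mlalg R F)
    (V : variety R F) (T : cocycle Q I) : Prop :=
  forall t s, identities V t s ->
  forall a q, cocycle_defect T t a q = cocycle_defect T s a q.

Definition sgn_scale (R : pzRingType) (A : lmodType R) (k : nat) (x : A) : A :=
  (-1) ^+ k *: x.

Record equiv_by (R : pzRingType) (F : opsig) (Q I : mlalg R F)
    (T T' : cocycle Q I) (h : Q -> I) : Prop := EquivBy {
  equiv_0 : h 0 = 0;
  equiv_add : forall x y, T_add T x y - T_add T' x y = h x + h y - h (x + y);
  equiv_scale : forall r x,
    T_scale T r x - T_scale T' r x = r *: h x - h (r *: x);
  equiv_op : forall (f : F) (x : {ffun 'I_(arity f) -> Q}),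
    let n := arity f in
    let hx := [ffun i => h (x i)] in
    T_op T x - T_op T' x =
      \sum_(s in star n) sgn_scale (1 + #|s|) (act T s x hx)
      + sgn_scale (1 + n) (ml_op hx) - h (ml_op x);
  equiv_act : forall (f : F) (s : {set 'I_(arity f)}), s \in star (arity f) ->
    forall (x : {ffun 'I_(arity f) -> Q}) (a : {ffun 'I_(arity f) -> I}),
    let n := arity f in
    let hx := [ffun i => h (x i)] in
    act T s x a - act T' s x a =
      \sum_(r in star n | s \proper r)
        sgn_scale (1 + (#|r| - #|s|)) (act T r x (subst_on s a hx))
      + sgn_scale (1 + (n - #|s|)) (ml_op (subst_on s a hx))
}.

Definition cocycle_equiv (R : pzRingType) (F : opsig) (Q I : mlalg R F)
    (T T' : cocycle Q I) : Prop :=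
  exists h : Q -> I, equiv_by T T' h.

Definition cocycle_class (R : pzRingType) (F : opsig) (Q I : mlalg R F)
    (V : variety R F) (T : cocycle Q I) : cocycle Q I -> Prop :=
  fun T' => compatible V T' /\ cocycle_equiv T T'.

Definition H2 (R : pzRingType) (F : opsig) (V : variety R F)
    (Q I : mlalg R F) : Type :=
  {c : cocycle Q I -> Prop | exists2 T, compatible V T & c = cocycle_class V T}.

Definition cohomology_class (R : pzRingType) (F : opsig) (Q I : mlalg R F)
    (V : variety R F) (T : cocycle Q I) (hT : compatible V T) : H2 V Q I :=
  exist _ (cocycle_class V T) (ex_intro2 _ _ T hT erefl).

Record extension (R : pzRingType) (F : opsig) (V : variety R F)
    (Q I : mlalg R F) := Extension {
  ext :> mlalg R F;
  ext_in_variety : V ext;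
  ext_inj : I -> ext;
  ext_proj : ext -> Q;
  ext_inj_hom : is_hom (A := to_algebra I) (B := to_algebra ext) ext_inj;
  ext_proj_hom : is_hom (A := to_algebra ext) (B := to_algebra Q) ext_proj;
  ext_inj_injective : injective ext_inj;
  ext_proj_surjective : forall q, exists m, ext_proj m = q;
  ext_exact : forall m, ext_proj m = 0 <-> exists a, ext_inj a = m
}.

Lemma ml_op_eq0 (R : pzRingType) (F : opsig) (A : mlalg R F) (f : F)
    (x : {ffun 'I_(arity f) -> A}) (i : 'I_(arity f)) :
  x i = 0 -> ml_op x = 0.
Proof.
move=> xi0; have := @ml_op_multilinear R F A f i (in_setT i) x (-1) 0 0.
have -> : update x i 0 = x.
  by apply/ffunP => j; rewrite ffunE; case: eqP => [->|].
have -> : update x i (-1 *: 0 + 0) = x.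
  by apply/ffunP => j; rewrite ffunE scaler0 addr0; case: eqP => [->|].
by rewrite scaleN1r addNr.
Qed.

Definition ext_ker (R : pzRingType) (F : opsig) (V : variety R F)
    (Q I : mlalg R F) (E : extension V Q I) : ideal E.
Proof.
refine (@Ideal R F E (fun m => ext_proj m = 0) _ _ _ _).
- exact: hom_zero (ext_proj_hom E).
- move=> x y x0 y0; have /= -> := hom_add (ext_proj_hom E) x y.
  by rewrite x0 y0 addr0.
- move=> r x x0; have /= -> := hom_scale (ext_proj_hom E) r x.
  by rewrite x0 scaler0.
- move=> f x i xi0; have /= -> := hom_op (ext_proj_hom E) x.
  by apply: (ml_op_eq0 (i := i)); rewrite ffunE.
Defined.

(* [E] is equivalent to the second projection $I\rtimes_T Q\to Q$, where the  *)
(* copy of [I] in $I\rtimes_T Q$ is $I\times\{0\}$.                           *)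
Definition ext_equiv_semidirect (R : pzRingType) (F : opsig) (V : variety R F)
    (Q I : mlalg R F) (E : extension V Q I) (T : cocycle Q I) : Prop :=
  exists phi : E -> I * Q,
  [/\ is_hom (A := to_algebra E) (B := semidirect T) phi,
      bijective phi,
      forall a : I, phi (ext_inj E a) = (a, 0)
    & forall m : E, (phi m).2 = ext_proj m].

Definition represents (R : pzRingType) (F : opsig) (V : variety R F)
    (Q I : mlalg R F) (c : H2 V Q I) (E : extension V Q I) : Prop :=
  exists2 T, sval c T & ext_equiv_semidirect E T.

(* Main.v *)
From HB Require Import structures.
Require Import Defs.
From mathcomp Require Import all_boot all_order all_algebra.

Set Implicit Arguments.
Unset Strict Implicit.
Unset Printing Implicit Defensive.

Import GRing.Theory.
Local Open Scope ring_scope.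

(** The congruence of an ideal [K] is abelian exactly when every operation
vanishes on tuples having two entries in [K]
([abelian_ops_vanish_twice], [ops_vanish_twice_abelian]).  One direction
applies the term condition to [f(x, y, z)] with [x] moving from [0] to an
element of [K] and [y] doing likewise.  For the other, expand [f(u + k)]
multilinearly for [k] in [K^n]: only the terms of degree at most one in [k]
survive, so [f] satisfies the parallelogram law
[f(u + k + l) + f(u) = f(u + k) + f(u + l)], and this law passes to all terms
by induction.

For the kernel of the second projection of the semidirect product of a cocycle
[T], expanding the operation on tuples with two entries in [I x {0}] and
isolating the action terms one at a time shows that the criterion means: the
operations of arity at least two vanish on [I], that is, [I] is abelian, and
[T] is linear ([semidirect_vanishP]).

An extension in the class of [T] is given by a cocycle [T'] equivalent to [T]
and possibly different from it.  When the operations of arity at least two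
vanish on [I], the difference of the action terms of [T] and [T'] at [s]
involves only action terms of [T] at strictly larger sets, so linearity goes
from [T'] to [T] by descending induction on [s] ([linear_cocycle_equiv]).
Conversely, compatibility makes the semidirect product satisfy every identity
of the variety, the module axioms and multilinearity among them; it is
therefore itself an extension in the class of [T] ([cocycle_extension]). *)

(** * Multilinear maps *)

Lemma update_id (n : nat) (A : Type) (x : {ffun 'I_n -> A}) (i : 'I_n) :
  update x i (x i) = x.
Proof. by apply/ffunP => j; rewrite ffunE; case: eqP => [->|]. Qed.

Lemma multilinear_onD (R : pzRingType) (n : nat) (A B : lmodType R)
    (s : {set 'I_n}) (g : {ffun 'I_n -> A} -> B) (i : 'I_n)
    (x : {ffun 'I_n -> A}) (u v : A) :
  multilinear_on s g -> i \in s ->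
  g (update x i (u + v)) = g (update x i u) + g (update x i v).
Proof. by move=> gl si; have := gl i si x 1 u v; rewrite !scale1r. Qed.

Lemma multilinear_on_eq0 (R : pzRingType) (n : nat) (A B : lmodType R)
    (s : {set 'I_n}) (g : {ffun 'I_n -> A} -> B) (i : 'I_n)
    (x : {ffun 'I_n -> A}) :
  multilinear_on s g -> i \in s -> x i = 0 -> g x = 0.
Proof.
move=> gl si xi0; apply: (addrI (g x)).
by rewrite addr0 -{1 2 3}(update_id x i) xi0 -(multilinear_onD _ _ _ gl si) addr0.
Qed.

(** The expansion of [g (u + v)] as the sum over all [s] of [g] at the tuple with
entries [u i] for [i] in [s] and [v i] elsewhere. *)
Lemma multilinear_expansion (R : pzRingType) (n : nat) (A B : lmodType R)
    (g : {ffun 'I_n -> A} -> B) (u v : {ffun 'I_n -> A}) :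
  multilinear_on [set: 'I_n] g ->
  g [ffun i => u i + v i] = \sum_(s : {set 'I_n}) g (subst_on s u v).
Proof.
move=> gl.
(* Only the coordinates in [S] are expanded; [S] then grows one index at a time. *)
suff expandA m (S : {set 'I_n}) (w : {ffun 'I_n -> A}) : #|S| = m ->
    g [ffun i => if i \in S then u i + w i else w i] =
    \sum_(s : {set 'I_n} | s \subset S) g (subst_on s u w).
  have := expandA _ [set: 'I_n] v erefl.
  under [RHS]eq_bigl => s do rewrite subsetT.
  by move=> <-; congr g; apply/ffunP => i; rewrite !ffunE in_setT.
elim: m S w => [|m IHm] S w.
  move/eqP; rewrite cards_eq0 => /eqP->.
  rewrite (big_pred1 set0) => [|s]; last by rewrite subset0.
  by congr g; apply/ffunP => i; rewrite !ffunE inE.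
move=> cardS; have /card_gt0P[i Si] : (0 < #|S|)%N by rewrite cardS.
have cardSi : #|S :\ i| = m by move: cardS; rewrite (cardsD1 i) Si => -[].
have -> : [ffun j => if j \in S then u j + w j else w j] =
    update [ffun j => if j \in S then u j + w j else w j] i (u i + w i).
  by apply/ffunP => j; rewrite !ffunE; case: eqP => // ->; rewrite Si.
rewrite (multilinear_onD _ _ _ gl) ?inE // (bigID (fun s : {set 'I_n} => i \in s)) /=.
(* The subsets of [S] containing [i] come from the value [u i] at [i], which
   amounts to expanding over [S :\ i] after putting [u i] into [w]; the other
   subsets come from the value [w i]. *)
congr (_ + _).
  transitivity (g [ffun j => if j \in S :\ i then u j + update w i (u i) j
                             else update w i (u i) j]).
    by congr g; apply/ffunP => j; rewrite !ffunE !inE; case: (j =P i).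
  rewrite (IHm _ _ cardSi).
  rewrite [RHS](reindex_onto (fun s => i |: s) (fun s => s :\ i)) /=; last first.
    by move=> s /andP[_ si]; rewrite setD1K.
  apply: eq_big => [s|s sS].
    apply/idP/idP => [sSi|/andP[/andP[isS _] /eqP <-]]; last by rewrite setSD.
    have nis : i \notin s by apply/negP => /(subsetP sSi); rewrite !inE eqxx.
    rewrite setU11 andbT setU1K // eqxx andbT subUset sub1set Si.
    exact: subset_trans sSi (subD1set S i).
  congr g; apply/ffunP => j; rewrite !ffunE !inE.
  by case: (j =P i) => [->|] //=; rewrite if_same.
transitivity (g [ffun j => if j \in S :\ i then u j + w j else w j]).
  by congr g; apply/ffunP => j; rewrite !ffunE !inE; case: (j =P i) => // ->.
by rewrite (IHm _ _ cardSi); apply: eq_bigl => s; rewrite subsetD1.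
Qed.

Lemma star_neq (n : nat) (s : {set 'I_n}) :
  s \in star n -> (exists i, i \in s) /\ (exists j, j \notin s).
Proof.
rewrite inE -subTset => /andP[/set0Pn[i si] /subsetPn[j _ sj]].
by split; [exists i|exists j].
Qed.

(** * Evaluation of terms *)

Lemma eq_teval (R : pzRingType) (F : opsig) (X : Type) (A : algebra R F)
    (v w : X -> A) (t : term R F X) : v =1 w -> teval v t = teval w t.
Proof.
move=> vw; elim: t => //= [t1 -> t2 ->|t ->|r t ->|f ts IH] //.
by congr alg_op; apply/ffunP => i; rewrite !ffunE IH.
Qed.

Lemma teval_hom (R : pzRingType) (F : opsig) (X : Type) (A B : algebra R F)
    (phi : A -> B) (v : X -> A) (t : term R F X) :
  is_hom phi -> phi (teval v t) = teval (phi \o v) t.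
Proof.
case=> h0 hD hN hZ hop; elim: t => //= [t1 IH1 t2 IH2|t IH|r t IH|f ts IH].
- by rewrite hD IH1 IH2.
- by rewrite hN IH.
- by rewrite hZ IH.
- by rewrite hop; congr alg_op; apply/ffunP => i; rewrite !ffunE IH.
Qed.

(** * Ideals whose congruence is abelian *)

Lemma idealN (R : pzRingType) (F : opsig) (M : mlalg R F) (K : ideal M) x :
  K x -> K (- x).
Proof. by move=> Kx; rewrite -scaleN1r; apply: idealZ. Qed.

Lemma ideal_sum (R : pzRingType) (F : opsig) (M : mlalg R F) (K : ideal M)
    (J : Type) (r : seq J) (P : pred J) (G : J -> M) :
  (forall j, P j -> K (G j)) -> K (\sum_(j <- r | P j) G j).
Proof.
move=> KG; apply: (big_ind (in_ideal K)) => //; first exact: ideal0.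
exact: idealD.
Qed.

(** The whole algebra, as an ideal of itself. *)
Definition full_ideal (R : pzRingType) (F : opsig) (M : mlalg R F) : ideal M.
Proof. by refine (@Ideal R F M (fun _ => True) _ _ _ _). Defined.

(** Terms preserve congruence modulo an ideal. *)
Lemma teval_ideal (R : pzRingType) (F : opsig) (M : mlalg R F) (K : ideal M)
    (X : Type) (v w : X -> M) (t : term R F X) :
  (forall x, K (v x - w x)) ->
  K (teval (A := to_algebra M) v t - teval (A := to_algebra M) w t).
Proof.
move=> Kvw; elim: t => /= [x||t1 IH1 t2 IH2|t IH|r t IH|f ts IH].
- exact: Kvw.
- by rewrite subrr; apply: ideal0.
- by rewrite opprD addrACA; apply: idealD.
- by rewrite -opprD; apply: idealN.
- by rewrite -scalerBr; apply: idealZ.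
set x := finfun _; set y := finfun _.
have Kxy i : K (x i - y i) by rewrite !ffunE.
have -> : x = [ffun i => [ffun i => x i - y i] i + y i].
  by apply/ffunP => i; rewrite !ffunE subrK.
rewrite (multilinear_expansion _ _ (@ml_op_multilinear R F M f)).
rewrite (bigD1 set0) //=.
have -> : subst_on set0 [ffun i => x i - y i] y = y.
  by apply/ffunP => i; rewrite !ffunE inE.
rewrite addrAC subrr add0r; apply: ideal_sum => s /set0Pn[i si].
by apply: (ideal_op (i := i)); rewrite ffunE si ffunE.
Qed.

(** Every operation vanishes on tuples with entries in [K] at two distinct
indices.  There is no condition on operations of arity one. *)
Definition ops_vanish_twice (R : pzRingType) (F : opsig) (M : mlalg R F)
    (K : M -> Prop) : Prop :=
  forall (f : F) (x : {ffun 'I_(arity f) -> M}) (i j : 'I_(arity f)),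
    i != j -> K (x i) -> K (x j) -> ml_op x = 0.

(** Each operation is affine on a coset of [K^n]: the terms of degree at least
two in the multilinear expansion vanish. *)
Lemma ml_op_parallelogram (R : pzRingType) (F : opsig) (M : mlalg R F)
    (K : ideal M) (f : F) (x k l : {ffun 'I_(arity f) -> M}) :
  ops_vanish_twice K -> (forall i, K (k i)) -> (forall i, K (l i)) ->
  ml_op [ffun i => k i + l i + x i] + ml_op x =
  ml_op [ffun i => k i + x i] + ml_op [ffun i => l i + x i].
Proof.
move=> van Kk Kl; have fl := @ml_op_multilinear R F M f.
have -> : [ffun i => k i + l i + x i] =
    [ffun i => [ffun i => k i + l i] i + x i].
  by apply/ffunP => i; rewrite !ffunE.
have {2}-> : x = [ffun i => [ffun=> 0] i + x i].
  by apply/ffunP => i; rewrite !ffunE add0r.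
rewrite !(multilinear_expansion _ _ fl) -!big_split; apply: eq_bigr => s _ /=.
have [->|/set0Pn[i si]] := eqVneq s set0.
  have substE (u : {ffun 'I_(arity f) -> M}) : subst_on set0 u x = x.
    by apply/ffunP => i; rewrite !ffunE inE.
  by rewrite !substE.
have [->|] := eqVneq s [set i].
  have substE (u : {ffun 'I_(arity f) -> M}) :
      subst_on [set i] u x = update x i (u i).
    by apply/ffunP => j; rewrite !ffunE inE; case: eqP => [->|].
  rewrite !substE !ffunE (multilinear_onD _ _ _ fl) ?inE //.
  by rewrite (ml_op_eq0 (i := i) (x := update x i 0)) ?addr0 // ffunE eqxx.
move=> ns1; have /subsetPn[j sj] : ~~ (s \subset [set i]).
  apply: contra ns1 => sub; rewrite eqEsubset sub sub1set; exact: si.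
rewrite inE eq_sym => nij.
have van0 (u : {ffun 'I_(arity f) -> M}) :
    (forall i, K (u i)) -> ml_op (subst_on s u x) = 0.
  by move=> Ku; apply: (van f _ i j nij); rewrite ffunE ?si ?sj.
rewrite !van0 // => i0; rewrite ffunE; [exact: ideal0|exact: idealD].
Qed.

Lemma eq_is_congruence (R : pzRingType) (F : opsig) (A : algebra R F) :
  is_congruence (A := A) eq.
Proof.
split=> [//|//|x y z -> //|x x' y y' -> -> //|x x' -> //|r x x' -> //|].
by move=> f x x' xx'; congr alg_op; apply/ffunP.
Qed.

(** The hypothesis on [al] covers both the congruence of an ideal and the total
congruence. *)
Lemma abelian_ops_vanish_twice (R : pzRingType) (F : opsig) (M : mlalg R F)
    (K : ideal M) (al : M -> M -> Prop) :
  (forall x y, al x y <-> K (x - y)) ->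
  abelian_congruence (A := to_algebra M) al -> ops_vanish_twice K.
Proof.
move=> alK ab f x i j nij Kxi Kxj; apply/ab => de deC Cde.
have al_refl y : al y y by apply/alK; rewrite subrr; apply: ideal0.
(* The term [f] with the [j]-th variable in the second group and the others in
   the first.  With [0] in place of [x i] it vanishes whatever the [j]-th entry
   is; the term condition then carries the equality over to [x]. *)
apply: (cong_sym deC).
pose t : term R F ('I_(arity f) + 'I_1) :=
  TOp (fun l => TVar R F (if l == j then inr ord0 else inl l)).
pose c (_ : 'I_1) : M := 0; pose d (_ : 'I_1) := x j.
have tE a e : teval (A := to_algebra M) (val2 a e) t =
    ml_op [ffun l => if l == j then e ord0 else a l].
  by congr ml_op; apply/ffunP => l; rewrite !ffunE; case: (l == j).
have := Cde _ _ t (update x i 0) x c d.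
rewrite !tE.
have -> : [ffun l => if l == j then d ord0 else x l] = x.
  by apply/ffunP => l; rewrite ffunE; case: eqP => [->|].
have zj a : ml_op [ffun l => if l == j then c ord0 else a l] = 0.
  by apply: (ml_op_eq0 (i := j)); rewrite ffunE eqxx.
rewrite !zj (ml_op_eq0 (i := i)); last by rewrite !ffunE (negPf nij) eqxx.
apply.
- move=> l; rewrite ffunE; case: eqP => [->|_]; last exact: al_refl.
  by apply/alK; rewrite sub0r; apply: idealN.
- by move=> l; apply/alK; rewrite /c /d sub0r; apply: idealN.
- exact: (cong_refl deC).
Qed.

(** The equality relation satisfies the term condition, because the values of a
term at the corners of a rectangle satisfy the parallelogram law. *)
Lemma ops_vanish_twice_abelian (R : pzRingType) (F : opsig) (M : mlalg R F)
    (K : ideal M) (al : M -> M -> Prop) :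
  (forall x y, al x y <-> K (x - y)) ->
  ops_vanish_twice K -> abelian_congruence (A := to_algebra M) al.
Proof.
move=> alK van x y; split=> [|-> de deC _]; last exact: (cong_refl deC).
apply; first exact: eq_is_congruence.
move=> m k t a b c d /= ab cd.
pose N (a : 'I_m -> M) (c : 'I_k -> M) t : M :=
  teval (A := to_algebra M) (val2 a c) t.
suff par : N b d t + N a c t = N b c t + N a d t.
  by move=> eqN; apply: (addIr (N a c t)); rewrite -/(N b d t) par /N eqN.
elim: t => /= [[i|j]||t1 IH1 t2 IH2|t IH|r t IH|f ts IH].
- by [].
- by rewrite addrC.
- by [].
- by rewrite addrACA IH1 IH2 addrACA.
- by rewrite -opprD IH opprD.
- by rewrite -scalerDr IH scalerDr.
rewrite /N /=.
set xbd := finfun _; set xac := finfun _; set xbc := finfun _; set xad := finfun _.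
have Kba i : K (xbc i - xac i).
  rewrite !ffunE; apply: teval_ideal => -[z|z] /=.
    by rewrite -opprB; apply: idealN; apply/alK.
  by rewrite subrr; apply: ideal0.
have Kdc i : K (xad i - xac i).
  rewrite !ffunE; apply: teval_ideal => -[z|z] /=.
    by rewrite subrr; apply: ideal0.
  by rewrite -opprB; apply: idealN; apply/alK.
have := @ml_op_parallelogram _ _ _ K f xac [ffun i => xbc i - xac i]
  [ffun i => xad i - xac i] van.
have -> : [ffun i => [ffun i => xbc i - xac i] i + [ffun i => xad i - xac i] i
    + xac i] = xbd.
  apply/ffunP => i; rewrite !ffunE -addrA subrK addrAC -/(N _ _ _) -/(N _ _ _).
  by rewrite -IH /N addrK.
have -> : [ffun i => [ffun i => xbc i - xac i] i + xac i] = xbc.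
  by apply/ffunP => i; rewrite !ffunE subrK.
have -> : [ffun i => [ffun i => xad i - xac i] i + xac i] = xad.
  by apply/ffunP => i; rewrite !ffunE subrK.
by apply => i; rewrite ffunE.
Qed.

(** * The extension attached to a compatible cocycle *)

(** The defect of a term is the difference between the first component of its
value in the semidirect product and its value in [I]; the second component is
its value in [Q].  So identities of [Q] and [I] with equal defects hold in the
semidirect product. *)
Lemma satisfies_semidirect (R : pzRingType) (F : opsig) (V : variety R F)
    (Q I : mlalg R F) (T : cocycle Q I) (t s : term R F nat) :
  V Q -> V I -> compatible V T -> identities V t s ->
  satisfies (semidirect T) t s.
Proof.
move=> VQ VI VT ts v.
have snd_hom : is_hom (A := semidirect T) (B := to_algebra Q) snd by [].
have pairE r : teval v r = teval (A := semidirect T) (fun x => ((v x).1, (v x).2)) r.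
  by apply: eq_teval => x; case: (v x).
apply: injective_projections; last first.
  by rewrite !(teval_hom _ _ snd_hom); apply: ts.
have := VT _ _ ts (fun x => (v x).1) (fun x => (v x).2).
rewrite /cocycle_defect -!pairE (ts I VI) => /addIr; exact.
Qed.

(** A copy of the carrier of the semidirect product.  It records the hypotheses
from which the module axioms follow, and keeps the twisted module structure
apart from the canonical one on [I * Q]. *)
Definition cocycle_ext (R : pzRingType) (F : opsig) (V : variety R F)
    (Q I : mlalg R F) (VQ : V Q) (VI : V I) (T : cocycle Q I)
    (VT : compatible V T) : Type := semidirect T.

Section CocycleExt.
Context (R : pzRingType) (F : opsig) (V : variety R F) (Q I : mlalg R F).
Context (VQ : V Q) (VI : V I) (T : cocycle Q I) (VT : compatible V T).
Local Notation M := (cocycle_ext VQ VI VT).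
Local Notation "t =Id s" := (identities V t s) (at level 70).
Local Notation X n := (TVar R F n).

Let sat (t s : term R F nat) (v : nat -> semidirect T) :
  t =Id s -> teval v t = teval v s.
Proof. by move=> ts; apply: satisfies_semidirect VQ VI VT ts v. Qed.

(* The valuation sending the first three variables to [x], [y], [z]. *)
Let val (x y z : semidirect T) (n : nat) := nth z [:: x; y] n.

Let extA : associative (@alg_add R F (semidirect T)).
Proof.
move=> x y z; apply: (@sat (TAdd (X 0) (TAdd (X 1) (X 2)))
  (TAdd (TAdd (X 0) (X 1)) (X 2)) (val x y z)) => A _ v; exact: addrA.
Qed.

Let extC : commutative (@alg_add R F (semidirect T)).
Proof.
move=> x y; apply: (@sat (TAdd (X 0) (X 1)) (TAdd (X 1) (X 0)) (val x y y)).
by move=> A _ v; apply: addrC.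
Qed.

Let ext0 : left_id (alg_zero (semidirect T)) (@alg_add R F (semidirect T)).
Proof.
move=> x; apply: (@sat (TAdd (TZero R F nat) (X 0)) (X 0) (val x x x)).
by move=> A _ v; apply: add0r.
Qed.

Let extN : left_inverse (alg_zero (semidirect T)) (@alg_opp R F (semidirect T))
  (@alg_add R F (semidirect T)).
Proof.
move=> x; apply: (@sat (TAdd (TOpp (X 0)) (X 0)) (TZero R F nat) (val x x x)).
by move=> A _ v; apply: addNr.
Qed.

Let extZA r r' x :
  alg_scale r (alg_scale r' x) = alg_scale (r * r') x :> semidirect T.
Proof.
apply: (@sat (TScale r (TScale r' (X 0))) (TScale (r * r') (X 0)) (val x x x)).
by move=> A _ v; apply: scalerA.
Qed.

Let extZ1 : left_id 1 (@alg_scale R F (semidirect T)).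
Proof.
move=> x; apply: (@sat (TScale 1 (X 0)) (X 0) (val x x x)).
by move=> A _ v; apply: scale1r.
Qed.

Let extZDr : right_distributive (@alg_scale R F (semidirect T))
  (@alg_add R F (semidirect T)).
Proof.
move=> r x y; apply: (@sat (TScale r (TAdd (X 0) (X 1)))
  (TAdd (TScale r (X 0)) (TScale r (X 1))) (val x y y)) => A _ v.
exact: scalerDr.
Qed.

Let extZDl x r r' : alg_scale (r + r') x =
  alg_add (alg_scale r x) (alg_scale r' x) :> semidirect T.
Proof.
apply: (@sat (TScale (r + r') (X 0)) (TAdd (TScale r (X 0)) (TScale r' (X 0)))
  (val x x x)) => A _ v.
exact: scalerDl.
Qed.

HB.instance Definition _ := Choice.copy M (I * Q)%type.
HB.instance Definition _ := GRing.isZmodule.Build M extA extC ext0 extN.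
HB.instance Definition _ :=
  GRing.Zmodule_isLmodule.Build R M extZA extZ1 extZDr extZDl.

(** Linearity in the [i]-th argument is an identity, in the variables [0], ...,
[n - 1] for the arguments and [n], [n + 1] for the two summands. *)
Lemma cocycle_ext_op_multilinear (f : F) :
  @multilinear_on R _ M M [set: 'I_(arity f)] (@alg_op R F (semidirect T) f).
Proof.
move=> i _ x r u v.
pose n := arity f.
pose w k : semidirect T := if insub k is Some j then x j else
  if k == n then u else v.
have wj (j : 'I_n) : w j = x j by rewrite /w valK.
have wu : w n = u by rewrite /w insubF ?ltnn ?eqxx.
have wv : w n.+1 = v by rewrite /w insubF ?ltnNge ?leqnSn // gtn_eqF.
pose t0 (s : term R F nat) := TOp (fun j : 'I_n => if j == i then s else X (j : nat)).
have t0E s : teval w (t0 s) = alg_op (update x i (teval w s)).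
  congr alg_op; apply/ffunP => j; rewrite !ffunE; case: ifP => //= _; exact: wj.
suff /(@sat _ _ w) eq_t : t0 (TAdd (TScale r (X n)) (X n.+1)) =Id
    TAdd (TScale r (t0 (X n))) (t0 (X n.+1)).
  transitivity (teval w (t0 (TAdd (TScale r (X n)) (X n.+1)))).
    by rewrite t0E [in RHS]/teval wu wv.
  rewrite eq_t [LHS]/(alg_add (alg_scale r (teval w (t0 (X n))))
    (teval w (t0 (X n.+1)))) !t0E [in LHS]/teval wu wv.
  by [].
move=> A _ a.
have tE s : teval (A := to_algebra A) a (t0 s) =
    ml_op (update [ffun j : 'I_n => a j] i (teval (A := to_algebra A) a s)).
  by congr ml_op; apply/ffunP => j; rewrite !ffunE; case: ifP.
pose ev s : A := teval (A := to_algebra A) a s.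
rewrite tE [RHS]/(r *: ev (t0 (X n)) + ev (t0 (X n.+1))) /ev !tE.
exact: (@ml_op_multilinear R F A f i (in_setT i)).
Qed.

(** The semidirect product, as a module expanded by multilinear operations. *)
Definition cocycle_ext_mlalg : mlalg R F :=
  @MLAlg R F M (@alg_op R F (semidirect T)) cocycle_ext_op_multilinear.

Lemma cocycle_ext_in_variety : V cocycle_ext_mlalg.
Proof.
have [E VE] := variety_equational V; apply/VE => t s Ets.
apply: (@satisfies_semidirect _ _ V) => // A /VE; exact.
Qed.

Lemma cocycle_ext_inj_hom : is_hom (A := to_algebra I)
  (B := to_algebra cocycle_ext_mlalg) (fun a => (a, 0)).
Proof.
split=> [//|x y|x|r x|f x] /=; congr pair; rewrite ?addr0 ?oppr0 ?scaler0 //.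
- by rewrite T_add_x0 addr0.
- by rewrite T_add_x0 subr0.
- by rewrite T_scale_0 addr0.
- pose j := Ordinal (arity_gt0 f).
  rewrite (T_op_0 T (i := j)) ?ffunE // addr0 big1 ?addr0 => [|s star_s].
    by congr ml_op; apply/ffunP => i; rewrite !ffunE.
  by have [_ [k sk]] := star_neq star_s; apply: (act_0 T star_s _ sk); rewrite !ffunE.
- by rewrite (ml_op_eq0 (i := Ordinal (arity_gt0 f))) ?ffunE.
Qed.

Lemma cocycle_ext_proj_hom :
  is_hom (A := to_algebra cocycle_ext_mlalg) (B := to_algebra Q) snd.
Proof. by []. Qed.

(** The second projection from the semidirect product, as an extension. *)
Definition cocycle_extension : extension V Q I.
Proof.
refine (@Extension R F V Q I cocycle_ext_mlalg cocycle_ext_in_variety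
  (fun a => (a, 0)) snd cocycle_ext_inj_hom cocycle_ext_proj_hom _ _ _).
- by move=> a b [].
- by move=> q; exists (0, q).
- by move=> [a q] /=; split=> [->|[b [_ <-]]]; first exists a.
Defined.

End CocycleExt.

Lemma cocycle_extension_equiv (R : pzRingType) (F : opsig) (V : variety R F)
    (Q I : mlalg R F) (VQ : V Q) (VI : V I) (T : cocycle Q I)
    (VT : compatible V T) :
  ext_equiv_semidirect (cocycle_extension VQ VI VT) T.
Proof.
exists id; split=> //; last by exists id.
split=> // f x; have {1}-> : x = [ffun i => id (x i)] by apply/ffunP => i; rewrite ffunE.
by [].
Qed.

(** * Linear cocycles *)

(** The operations of the semidirect product vanish on tuples with entries in
[I x {0}] at two distinct indices.  The semidirect product of an arbitrary
cocycle need not be a module, hence the separate definition. *)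
Definition semidirect_vanish (R : pzRingType) (F : opsig) (Q I : mlalg R F)
    (T : cocycle Q I) : Prop :=
  forall (f : F) (p : {ffun 'I_(arity f) -> semidirect T}) i j, i != j ->
    (p i).2 = 0 -> (p j).2 = 0 -> alg_op p = alg_zero (semidirect T).

Lemma semidirect_vanishP (R : pzRingType) (F : opsig) (Q I : mlalg R F)
    (T : cocycle Q I) :
  semidirect_vanish T <-> ops_vanish_twice (full_ideal I) /\ linear_cocycle T.
Proof.
split=> [van|[vanI linT] f p i j nij pi0 pj0]; last first.
  congr pair; last by rewrite (ml_op_eq0 (i := i)) ?ffunE.
  rewrite (vanI f _ i j nij) // (T_op_0 T (i := i)) ?ffunE // add0r addr0.
  rewrite big1 // => s star_s; have [s_gt1|s_le1] := ltnP 1 #|s|.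
    exact: linT.
  have [si|si] := boolP (i \in s); last by apply: (act_0 T star_s _ si); rewrite ffunE.
  have [sj|sj] := boolP (j \in s); last by apply: (act_0 T star_s _ sj); rewrite ffunE.
  by move: nij; rewrite (card_le1_eqP s_le1 i j si sj) eqxx.
split=> [f a i j nij _ _|f s star_s /card_gt1P[i [j [si sj nij]]] q a].
  have := van f [ffun k => (a k, 0)] i j nij; rewrite !ffunE => /(_ erefl erefl) [+ _].
  rewrite (T_op_0 T (i := i)) ?ffunE // addr0 big1 ?addr0 => [eq0|s star_s].
    by rewrite -[RHS]eq0; congr ml_op; apply/ffunP => k; rewrite !ffunE.
  by have [_ [k sk]] := star_neq star_s; apply: (act_0 T star_s _ sk); rewrite !ffunE.
have [_ [k sk]] := star_neq star_s.
(* With entries in [I x {0}] on [s] and in [{0} x Q] off [s], the action term at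
   [s] is the only summand that survives. *)
have := van f [ffun l => if l \in s then (a l, 0) else (0, q l)] i j nij.
rewrite !ffunE si sj => /(_ erefl erefl) [+ _].
rewrite (T_op_0 T (i := i)) ?ffunE ?ffunE ?si // addr0.
rewrite (ml_op_eq0 (i := k)) ?ffunE ?ffunE ?(negPf sk) // add0r.
rewrite (bigD1 s) //= big1 ?addr0 => [eq0|r /andP[star_r nrs]].
  rewrite -[RHS]eq0; apply: act_dep => // l.
    by move=> /negPf sl; rewrite !ffunE sl.
  by move=> sl; rewrite !ffunE sl.
have [rs|/subsetPn[l rl /negPf sl]] := boolP (r \subset s); last first.
  by apply: (multilinear_on_eq0 (act_multilinear T star_r _) rl); rewrite !ffunE sl.
have /subsetPn[l sl rl] : ~~ (s \subset r).
  by apply: contra nrs => sr; rewrite eqEsubset rs.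
by apply: (act_0 T star_r _ rl); rewrite !ffunE sl.
Qed.

Lemma ext_ker_vanish (R : pzRingType) (F : opsig) (V : variety R F)
    (Q I : mlalg R F) (E : extension V Q I) (T : cocycle Q I) :
  ext_equiv_semidirect E T ->
  ops_vanish_twice (ext_ker E) <-> semidirect_vanish T.
Proof.
move=> [phi [phi_hom phi_bij _ phi_proj]]; split=> van f.
  case: phi_bij => psi phiK psiK p i j nij pi0 pj0.
  have -> : p = [ffun k => phi ([ffun k => psi (p k)] k)].
    by apply/ffunP => k; rewrite !ffunE psiK.
  rewrite -(hom_op phi_hom) -(hom_zero phi_hom); congr phi.
  by apply: (van f _ i j nij); rewrite ffunE /= -phi_proj psiK.
move=> x i j nij xi0 xj0; apply: (bij_inj phi_bij).
rewrite [LHS](hom_op phi_hom) [RHS](hom_zero phi_hom).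
by apply: (van f _ i j nij); rewrite ffunE phi_proj.
Qed.

Lemma equiv_by_refl (R : pzRingType) (F : opsig) (Q I : mlalg R F)
    (T : cocycle Q I) : equiv_by T T (fun=> 0).
Proof.
split=> [//|x y|r x|f x n hx|f s star_s x a n hx].
- by rewrite !subrr addr0 subr0.
- by rewrite scaler0 subr0 subrr.
- rewrite subrr subr0 (ml_op_eq0 (i := Ordinal (arity_gt0 f))) ?ffunE //.
  rewrite /sgn_scale scaler0 addr0 big1 // => s star_s.
  have [[i si] _] := star_neq star_s.
  by rewrite (multilinear_on_eq0 (act_multilinear T star_s _) si) ?scaler0 ?ffunE.
have [_ [k sk]] := star_neq star_s.
rewrite subrr (ml_op_eq0 (i := k)) ?ffunE ?(negPf sk) ?ffunE //.
rewrite /sgn_scale scaler0 addr0 big1 // => r /andP[star_r /properP[_ [l rl sl]]].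
rewrite (multilinear_on_eq0 (act_multilinear T star_r _) rl) ?scaler0 //.
by rewrite !ffunE (negPf sl).
Qed.

(** A set [s] with more than one element forces arity at least two, so the
operations of [I] drop out of the formula for equivalent action terms. *)
Lemma linear_cocycle_equiv (R : pzRingType) (F : opsig) (Q I : mlalg R F)
    (T T' : cocycle Q I) :
  ops_vanish_twice (full_ideal I) -> cocycle_equiv T T' ->
  linear_cocycle T' -> linear_cocycle T.
Proof.
move=> vanI [h TT'] linT' f s.
have [m] := ubnP (arity f - #|s|)%N; elim: m s => // m IHm s ltm star_s s_gt1 q a.
have /card_gt1P[i [j [_ _ nij]]] := s_gt1.
have := equiv_act TT' star_s q a.
rewrite (linT' f s star_s s_gt1) subr0 => ->.
rewrite (vanI f _ i j nij) // /sgn_scale scaler0 addr0.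
apply: big1 => r /andP[star_r /proper_card lt_sr].
rewrite IHm ?scaler0 //; last exact: ltn_trans lt_sr.
rewrite ltnS in ltm; apply: leq_trans ltm.
by apply: ltn_sub2l => //; apply: leq_trans lt_sr _; rewrite -[X in (_ <= X)%N]card_ord max_card.
Qed.

Lemma abelian_algebraP (R : pzRingType) (F : opsig) (M : mlalg R F) :
  abelian_algebra (to_algebra M) <-> ops_vanish_twice (full_ideal M).
Proof.
by split; [apply: abelian_ops_vanish_twice|apply: ops_vanish_twice_abelian].
Qed.

Lemma ext_ker_abelianP (R : pzRingType) (F : opsig) (V : variety R F)
    (Q I : mlalg R F) (E : extension V Q I) (T : cocycle Q I) :
  ext_equiv_semidirect E T ->
  abelian_congruence (A := to_algebra E) (ideal_congruence (ext_ker E)) <->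
  abelian_algebra (to_algebra I) /\ linear_cocycle T.
Proof.
move=> /ext_ker_vanish [to_van of_van]; split=> [abE|[abI linT]].
  have [vanI linT] : ops_vanish_twice (full_ideal I) /\ linear_cocycle T.
    by apply/semidirect_vanishP/to_van/(abelian_ops_vanish_twice _ abE).
  by split=> //; apply/abelian_algebraP.
apply: ops_vanish_twice_abelian (of_van _) => //.
by apply/semidirect_vanishP; split=> //; apply/abelian_algebraP.
Qed.

Theorem theorem3p30 (R : pzRingType) (F : opsig) (V : variety R F)
    (Q I : mlalg R F) (hQ : V Q) (hI : V I)
    (T : cocycle Q I) (hT : compatible V T) :
  (exists E : extension V Q I,
     represents (cohomology_class hT) E /\
     abelian_congruence (A := to_algebra E) (ideal_congruence (ext_ker E)))
  <-> (abelian_algebra (to_algebra I) /\ linear_cocycle T).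
Proof.
split=> [[E [[T' [_ TT'] ET'] abE]]|abT].
  have [abI linT'] := (ext_ker_abelianP ET').1 abE.
  split=> //; apply: linear_cocycle_equiv TT' linT'.
  exact/abelian_algebraP.
exists (cocycle_extension hQ hI hT); split.
  exists T; last exact: cocycle_extension_equiv.
  by split=> //; exists (fun=> 0); apply: equiv_by_refl.
exact/(ext_ker_abelianP (cocycle_extension_equiv hQ hI hT)).
Qed.
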